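(* Let $k,n>1$ be integers. (1) If a $\sigma_n$-$k$-partition admits a transitive $\sigma_n$-orientation, then so does its dual. (2) If a $\sigma_n$-$k$-partition $P$ admits a transitive $\sigma_n$-orientation and the defining sequence of $P$ jumps at an index $i$, then either there is an index $j<i$ where it halts and there are at least $k-1$ distinct indices $j'<i$ where it steps, or the other way around: there is an index $j<i$ where it steps and there are at least $k-1$ distinct indices $j'<i$ where it halts. In particular, there is no jump at indices $i\le k$.
   Context: $K_n$ is the complete graph on the vertex set $[n]=\{0,1,\dots,n-1\}$; vertices are considered as residue classes modulo $n$, and $\sigma_n$ is the cyclic permutation of $[n]$ with $\sigma_n(i)=i+1$ (mod $n$), acting also on edges, graphs and digraphs. A $\sigma_n$-$k$-partition is a partition of the edge set of $K_n$ into subgraphs $F_0,\dots,F_{k-1}$ with $\sigma_n(F_d)=F_{d+1}$ for $0\le d<k-1$. (This forces $k\mid n$, and $2k\mid n$ if $k$ is even; also $\sigma_n(F_{k-1})=F_0$.) The label of an edge $e\in F_d$ is $\ell(e)=d$. The defining sequence of the partition is $a_1,\dots,a_{\lfloor n/2\rfloor}$ with $a_i=\ell(\{0,i\})\in\{0,\dots,k-1\}$. The defining sequence uniquely determines the partition ($F_d$ consists of the edges $\{b,b+i\}$, $1\le i\le\lfloor n/2\rfloor$, with $b\equiv d-a_i\pmod k$), and when the divisibility conditions hold, every sequence of length $\lfloor n/2\rfloor$ over $\{0,\dots,k-1\}$ is the defining sequence of a $\sigma_n$-$k$-partition. A transitive orientation $T$ of $K_n$ (i.e. a transitive tournament on $[n]$)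 is a transitive $\sigma_n$-orientation of the $\sigma_n$-$k$-partition if $\sigma_n(\vec F_d)=\vec F_{d+1}$ for $0\le d<k-1$, where $\vec F_d$ is the orientation of $F_d$ obtained as a subgraph of $T$. Let $a_1,\dots,a_{\lfloor n/2\rfloor}$ be the defining sequence of a $\sigma_n$-$k$-partition $P$. For an index $i$ with $1\le i<\lfloor n/2\rfloor$, the sequence halts at $i$ if $a_{i+1}=a_i$; it steps at $i$ if $a_{i+1}\equiv a_i+1\pmod k$; it jumps at $i$ if it neither halts nor steps there. The dual of $P$ is the $\sigma_n$-$k$-partition with defining sequence $b_1,\dots,b_{\lfloor n/2\rfloor}$ (with entries in $\{0,\dots,k-1\}$) where $b_i\equiv i-1-a_i\pmod k$ for all $i$. *)

(* Defs.v *)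
From mathcomp Require Import all_boot.
From mathcomp Require Import zify.

Set Implicit Arguments.
Unset Strict Implicit.
Unset Printing Implicit Defensive.

(* The cyclic permutation sigma_n of [n] = 'I_n is [ordS n]. *)

Definition Kn_edges n : {set {set 'I_n}} := [set e : {set 'I_n} | #|e| == 2].

(* The pair {b, b + i}, vertices being read as residue classes modulo n. *)
Definition edge n (b i : nat) : {set 'I_n} :=
  [set x : 'I_n | (x == b %[mod n]) || (x == b + i %[mod n])].

Definition sigma_edge n (e : {set 'I_n}) : {set 'I_n} := [set ordS x | x in e].

Definition sigma_graph n (G : {set {set 'I_n}}) : {set {set 'I_n}} :=
  [set sigma_edge e | e in G].

Definition sigma_digraph n (D : {set 'I_n * 'I_n}) : {set 'I_n * 'I_n} :=
  [set (ordS p.1, ordS p.2) | p in D].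

(* Injectivity turns the set partition {F_0, ..., F_(k-1)} into an indexed
   family of k pairwise disjoint blocks. *)
Definition sigma_partition k n (F : 'I_k -> {set {set 'I_n}}) : Prop :=
  [/\ injective F,
      partition [set F d | d : 'I_k] (Kn_edges n) &
      forall d d' : 'I_k, d' = d.+1 :> nat -> sigma_graph (F d) = F d'].

(* The default value 0 is only used for sets that are not edges. *)
Definition label k n (F : 'I_k -> {set {set 'I_n}}) (e : {set 'I_n}) : nat :=
  if [pick d | e \in F d] is Some d then d else 0.

(* Only the values at 1 <= i <= n./2 are meaningful. *)
Definition defining_seq k n (F : 'I_k -> {set {set 'I_n}}) (i : nat) : nat :=
  label F (edge n 0 i).

Definition partition_of_seq k n (a : nat -> nat) (d : 'I_k) :
    {set {set 'I_n}} :=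
  [set e : {set 'I_n} | [exists b : 'I_n, exists i : 'I_n,
     [&& 0 < i, i <= n./2, e == edge n b i & b + a i == d %[mod k]]]].

(* The residue of i - 1 - a_i modulo k; as a_i < k and 1 <= i, neither
   subtraction truncates. *)
Definition dual_seq (k : nat) (a : nat -> nat) (i : nat) : nat :=
  (i - 1 + (k - a i)) %% k.

Definition dual k n (F : 'I_k -> {set {set 'I_n}}) :
    'I_k -> {set {set 'I_n}} :=
  partition_of_seq n (dual_seq k (defining_seq F)).

Definition transitive_tournament n (T : rel 'I_n) : Prop :=
  [/\ irreflexive T, transitive T & forall x y, x != y -> T x y (+) T y x].

Definition oriented n (T : rel 'I_n) (G : {set {set 'I_n}}) :
    {set 'I_n * 'I_n} :=
  [set p : 'I_n * 'I_n | T p.1 p.2 && ([set p.1; p.2] \in G)].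

Definition transitive_sigma_orientation k n (F : 'I_k -> {set {set 'I_n}})
    (T : rel 'I_n) : Prop :=
  transitive_tournament T /\
  forall d d' : 'I_k, d' = d.+1 :> nat ->
    sigma_digraph (oriented T (F d)) = oriented T (F d').

Definition admits_transitive_sigma_orientation k n
    (F : 'I_k -> {set {set 'I_n}}) : Prop :=
  exists T : rel 'I_n, transitive_sigma_orientation F T.

Definition seq_index (n i : nat) : bool := (1 <= i) && (i < n./2).

Definition halts (n : nat) (a : nat -> nat) (i : nat) : bool :=
  seq_index n i && (a i.+1 == a i).

Definition steps (k n : nat) (a : nat -> nat) (i : nat) : bool :=
  seq_index n i && (a i.+1 == a i + 1 %[mod k]).

Definition jumps (k n : nat) (a : nat -> nat) (i : nat) : bool :=
  [&& seq_index n i, ~~ halts n a i & ~~ steps k n a i].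

Lemma dual_seqE k a i : 0 < i -> a i <= k ->
  dual_seq k a i + a i + 1 = i %[mod k].
Proof.
move=> i0 ak; rewrite /dual_seq -addnA modnDml.
have -> : i - 1 + (k - a i) + (a i + 1) = i + k by lia.
by rewrite modnDr.
Qed.

Lemma edgeC n b i : i <= n -> edge n (b + i) (n - i) = edge n b i.
Proof.
move=> hi.
apply/setP=> x; rewrite !inE -addnA subnKC // modnDr; exact: orbC.
Qed.

Lemma edge_modn n b i : edge n (b %% n) i = edge n b i.
Proof. by apply/setP=> x; rewrite !inE modn_mod modnDml. Qed.

Lemma sigma_edgeE n b i : sigma_edge (edge n b i) = edge n b.+1 i.
Proof.
have E (x : 'I_n) c : (ordS x == c.+1 %[mod n]) = (x == c %[mod n]).
  by rewrite /= modn_mod -(addn1 x) -(addn1 c) eqn_modDr.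
apply/setP=> y; apply/imsetP/idP => [[x hx ->]|].
  by move: hx; rewrite !inE addSn !E.
move=> hy; exists (ord_pred y); last by rewrite ord_predK.
by move: hy; rewrite -{1}(ord_predK y) !inE addSn !E.
Qed.

Lemma iter_sigma_edge n b i j :
  iter j (@sigma_edge n) (edge n b i) = edge n (b + j) i.
Proof.
by elim: j => [|j IH]; rewrite ?addn0 //= IH sigma_edgeE addnS.
Qed.

Lemma sigma_edge_inj n : injective (@sigma_edge n).
Proof. exact/imset_inj/(can_inj (@ordSK n)). Qed.

Lemma card_sigma_edge n (e : {set 'I_n}) : #|sigma_edge e| = #|e|.
Proof. by rewrite card_imset //; exact/(can_inj (@ordSK n)). Qed.

Lemma edge_in n (b i : nat) : 0 < i -> i < n -> edge n b i \in Kn_edges n.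
Proof.
move=> i0 lin; have n0 : 0 < n by lia.
have -> : edge n b i =
    [set Ordinal (ltn_pmod b n0); Ordinal (ltn_pmod (b + i) n0)].
  by apply/setP=> x; rewrite !inE -!val_eqE /= (modn_small (ltn_ord x)).
rewrite inE cards2 -val_eqE /=.
case: eqP => // /eqP; rewrite -{1}[b]addn0 eqn_modDl mod0n modn_small //; lia.
Qed.

Lemma edge_ex n (e : {set 'I_n}) : e \in Kn_edges n ->
  exists b i : 'I_n, [/\ 0 < i, i <= n./2 & e = edge n b i].
Proof.
rewrite inE => /cards2P [x [y [nxy ->]]].
wlog lt_xy : x y nxy / x < y.
  move=> H; have := nxy; rewrite -val_eqE neq_ltn => /orP [] h; first exact: (H x y).
  by rewrite setUC; apply: (H y x); rewrite // eq_sym.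
have hy := ltn_ord y; have hi : y - x < n by lia.
have hj : n - (y - x) < n by lia.
have E : [set x; y] = edge n x (y - x).
  apply/setP=> z; rewrite !inE subnKC ?(ltnW lt_xy) //.
  by rewrite !modn_small ?ltn_ord // !val_eqE.
case: (leqP (y - x) n./2) => h.
  by exists x, (Ordinal hi); split=> //=; lia.
exists y, (Ordinal hj); split=> /=; [lia | lia |].
by rewrite E -(@edgeC n x (y - x)) ?subnKC ?(ltnW lt_xy) ?(ltnW hi).
Qed.

Lemma edge_inj n (b b' i i' : nat) : b < n -> b' < n ->
    0 < i <= n./2 -> 0 < i' <= n./2 -> edge n b i = edge n b' i' ->
  i = i' /\ (b = b' \/ n = i.*2 /\ (b' = b + i \/ b = b' + i)).
Proof.
move=> hb hb' hi hi' /setP E.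
have n0 : 0 < n by lia.
have R (c j : nat) : c < n -> 0 < j <= n./2 ->
    (c + j) %% n = if c + j < n then c + j else c + j - n.
  move=> hc hj; case: ltnP => h; first by rewrite modn_small.
  by rewrite -{1}(subnK h) modnDr modn_small //; lia.
have M (x : nat) : x < n ->
    ((x == b) || (x == (b + i) %% n)) = ((x == b') || (x == (b' + i') %% n)).
  move=> hx; have := E (Ordinal hx).
  by rewrite !inE /= (modn_small hx) (modn_small hb) (modn_small hb').
have h1 := M b hb; have h2 := M _ (ltn_pmod (b + i) n0).
have h3 := M b' hb'; have h4 := M _ (ltn_pmod (b' + i') n0).
move: h1 h2 h3 h4; rewrite !eqxx !orbT !R //; clear M E R.
by case: ltnP => h5; case: ltnP => h6; lia.
Qed.

Section Partition.
Variables (k n : nat) (F : 'I_k -> {set {set 'I_n}}).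
Hypothesis pF : sigma_partition F.

Lemma block_ex e : e \in Kn_edges n -> exists d, e \in F d.
Proof.
case: pF => _ /cover_partition <- _ /bigcupP [A /imsetP [d _ ->]] h.
by exists d.
Qed.

Lemma block_sub d e : e \in F d -> e \in Kn_edges n.
Proof.
case: pF => _ /cover_partition <- _ h.
by apply/bigcupP; exists (F d) => //; apply: imset_f.
Qed.

Lemma block_uniq e d d' : e \in F d -> e \in F d' -> d = d'.
Proof.
case: pF => iF /partition_trivIset /trivIsetP tF _ h h'.
apply: iF; apply/eqP/negPn/negP => ne.
have := tF _ _ (imset_f _ (isT : d \in predT)) (imset_f _ (isT : d' \in predT)) ne.
by move/disjointFr => /(_ _ h); rewrite h'.
Qed.

Lemma labelE e d : e \in F d -> label F e = d.
Proof.
rewrite /label => h; case: pickP => [d' h'|/(_ d)]; last by rewrite h.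
by rewrite (block_uniq h h').
Qed.

Lemma label_sigma e : e \in Kn_edges n ->
  label F (sigma_edge e) = (label F e).+1 %% k.
Proof.
move=> he; have [d hd] := block_ex he; have hk := ltn_ord d.
rewrite (labelE hd); case: pF => _ _ sF.
have [d' hd'] : exists d', sigma_edge e \in F d'.
  by apply: block_ex; rewrite inE card_sigma_edge; rewrite inE in he.
rewrite (labelE hd'); case: (ltnP d.+1 k) => h.
  have S : sigma_edge e \in F (Ordinal h).
    by rewrite -(sF d (Ordinal h)) //; apply: imset_f.
  by rewrite (block_uniq hd' S) modn_small.
have -> : d.+1 = k by lia.
rewrite modnn; case: (posnP d') => // d'0; exfalso.
have hp : d'.-1 < k by have := ltn_ord d'; lia.
move: hd'; rewrite -(sF (Ordinal hp) d') /= ?prednK //.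
case/imsetP => e' he' /sigma_edge_inj E; rewrite -E in he'.
by have /(congr1 val) /= := block_uniq hd he'; have := ltn_ord d'; lia.
Qed.

Lemma label_edge b i : 0 < i < n ->
  label F (edge n b i) = (b + defining_seq F i) %% k.
Proof.
case/andP=> i0 lin; rewrite /defining_seq.
elim: b => [|b IH].
  have [d hd] := block_ex (edge_in 0 i0 lin).
  by rewrite add0n (labelE hd) modn_small ?ltn_ord.
by rewrite -sigma_edgeE label_sigma ?edge_in // IH -addn1 modnDml addn1.
Qed.

Lemma defining_seq_lt i : 0 < i < n -> defining_seq F i < k.
Proof.
case/andP=> i0 lin; have [d hd] := block_ex (edge_in 0 i0 lin).
by rewrite /defining_seq (labelE hd).
Qed.

Lemma sigma_partition_dvdn : 1 < n -> k %| n /\ (~~ odd n -> k %| n./2).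
Proof.
move=> n1.
have K c i : 0 < i < n -> edge n c i = edge n 0 i -> k %| c.
  move=> hi /(congr1 (label F)); rewrite !label_edge // => /eqP.
  by rewrite eqn_modDr mod0n.
split=> [|on].
  by apply: (K n 1) => //; rewrite -edge_modn modnn.
apply: (K n./2 n./2); first by lia.
rewrite -(@edgeC n 0 n./2); last by lia.
by rewrite add0n; congr edge; lia.
Qed.

Lemma partition_of_defining_seq : partition_of_seq n (defining_seq F) =1 F.
Proof.
move=> d; apply/setP=> e; rewrite inE; apply/idP/idP.
  case/existsP=> b /existsP [i /and4P [i0 _ /eqP -> /eqP h]].
  have hi : 0 < i < n by rewrite i0 ltn_ord.
  have [d' hd'] := block_ex (edge_in b i0 (ltn_ord i)).
  suff -> : d = d' by [].
  by apply: val_inj; rewrite /= -(labelE hd') label_edge // h modn_small.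
move=> hd; have [b [i [i0 hi Ee]]] := edge_ex (block_sub hd).
apply/existsP; exists b; apply/existsP; exists i; rewrite i0 hi Ee eqxx /=.
rewrite -label_edge ?i0 ?ltn_ord // -Ee (labelE hd) modn_small //.
Qed.

End Partition.

Section OfSeq.
Variables (k n : nat) (a : nat -> nat).
Hypotheses (k1 : 0 < k) (n1 : 1 < n) (kn : k %| n)
  (kn2 : ~~ odd n -> k %| n./2).

Lemma mem_partition_of_seq (b i : nat) (d : 'I_k) : b < n -> 0 < i <= n./2 ->
  (edge n b i \in partition_of_seq n a d) = (b + a i == d %[mod k]).
Proof.
move=> hb hi; rewrite inE; apply/idP/idP; last first.
  have ltin : i < n by lia.
  move=> h; apply/existsP; exists (Ordinal hb).
  by apply/existsP; exists (Ordinal ltin); case/andP: hi => /= -> ->; rewrite eqxx.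
case/existsP=> b' /existsP [i' /and4P [i0 hi' /eqP E /eqP <-]].
have hi'' : 0 < i' <= n./2 by rewrite i0.
case: (edge_inj hb (ltn_ord b') hi hi'' E) => <- [-> //|[En D]].
have /dvdnP [q Eq] : k %| i.
  have -> : i = n./2 by lia.
  by apply: kn2; lia.
by rewrite eqn_modDr; case: D => ->; rewrite Eq addnC modnMDl.
Qed.

Lemma partition_of_seqP : sigma_partition (@partition_of_seq k n a).
Proof.
have k_le : k <= n by apply: dvdn_leq => //; lia.
have U e d d' : e \in partition_of_seq n a d ->
    e \in partition_of_seq n a d' -> d = d' :> 'I_k.
  rewrite {1}inE => /existsP [b /existsP [i /and4P [i0 hi /eqP -> /eqP h]]].
  rewrite mem_partition_of_seq ?i0 // => /eqP; rewrite h !modn_small //.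
  exact: val_inj.
have N (d : 'I_k) : exists e, e \in partition_of_seq n a d.
  pose b := (d + (k - a 1 %% k)) %% k.
  have hb : b < n by apply: leq_trans (ltn_pmod _ k1) k_le.
  exists (edge n b 1); rewrite mem_partition_of_seq //; last by lia.
  have := ltn_pmod (a 1) k1 => h; rewrite /b modnDml -modnDmr -addnA.
  by rewrite subnK ?(ltnW h) // modnDr.
have S (d : 'I_k) e : e \in partition_of_seq n a d -> e \in Kn_edges n.
  rewrite inE => /existsP [b /existsP [i /and4P [i0 hi /eqP -> _]]].
  exact: edge_in.
have X e : e \in Kn_edges n -> exists d : 'I_k, e \in partition_of_seq n a d.
  case/edge_ex => b [i [i0 hi ->]]; exists (Ordinal (ltn_pmod (b + a i) k1)).
  by rewrite mem_partition_of_seq ?i0 //= modn_mod.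
have G (b i : nat) (d : 'I_k) : 0 < i <= n./2 ->
    (edge n b i \in partition_of_seq n a d) = (b + a i == d %[mod k]).
  move=> hi; rewrite -edge_modn mem_partition_of_seq ?ltn_pmod //; last by lia.
  by rewrite -modnDml modn_dvdm // modnDml.
split=> [d d' E||d d' Ed].
- by have [e he] := N d; apply: (U e) => //; rewrite -E.
- apply/and3P; split.
  + apply/eqP/setP=> e; apply/bigcupP/idP => [[A /imsetP [d _ ->]]|/X [d hd]].
      exact: S.
    by exists (partition_of_seq n a d) => //; apply: imset_f.
  + apply/trivIsetP=> A B /imsetP [d _ ->] /imsetP [d' _ ->] ne.
    rewrite -setI_eq0; apply/eqP/setP=> e; rewrite in_set0 in_setI.
    apply/negP=> /andP [h h']; move/eqP: ne; apply.
    by rewrite (U e _ _ h h').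
  + apply/negP=> /imsetP [d _ E]; have [e] := N d.
    by rewrite -E in_set0.
- apply/setP=> e; apply/imsetP/idP => [[e' he' ->]|he].
    have [b [i [i0 hi Ee]]] := edge_ex (S _ _ he').
    have hi' : 0 < i <= n./2 by rewrite i0.
    move: he'; rewrite Ee sigma_edgeE !G // Ed addSn -(addn1 (b + _)).
    by rewrite -(addn1 d) eqn_modDr.
  have [b [i [i0 hi Ee]]] := edge_ex (S _ _ he).
  have hi' : 0 < i <= n./2 by rewrite i0.
  have Eb : edge n (ord_pred b).+1 i = edge n b i.
    by rewrite -{2}(ord_predK b) -[RHS]edge_modn /= modn_mod edge_modn.
  exists (edge n (ord_pred b) i); last by rewrite sigma_edgeE Eb.
  move: he; rewrite Ee -Eb !G // Ed addSn -(addn1 (_ + a i)).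
  by rewrite -(addn1 d) eqn_modDr.
Qed.

Lemma defining_seq_of_seq i : 0 < i <= n./2 -> a i < k ->
  defining_seq (@partition_of_seq k n a) i = a i.
Proof.
move=> hi ak; apply: (@labelE _ _ _ partition_of_seqP _ (Ordinal ak)).
by rewrite mem_partition_of_seq //; lia.
Qed.

End OfSeq.

Lemma dual_sigma_partition k n (F : 'I_k -> {set {set 'I_n}}) :
  1 < n -> sigma_partition F -> sigma_partition (dual F).
Proof.
move=> n1 pF; have [kn kn2] := sigma_partition_dvdn pF n1.
apply: partition_of_seqP => //.
by have /(block_ex pF) [d _] : edge n 0 1 \in Kn_edges n;
  [exact: edge_in | have := ltn_ord d; lia].
Qed.

Lemma defining_seq_dual k n (F : 'I_k -> {set {set 'I_n}}) i :
    1 < n -> sigma_partition F -> 0 < i <= n./2 ->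
  defining_seq (dual F) i = dual_seq k (defining_seq F) i.
Proof.
move=> n1 pF hi; have [kn kn2] := sigma_partition_dvdn pF n1.
have k0 : 0 < k by have := @defining_seq_lt _ _ _ pF i; lia.
by apply: defining_seq_of_seq; rewrite // ltn_pmod.
Qed.

(* Main.v *)
Require Import Defs.
From mathcomp Require Import all_boot.
From mathcomp Require Import zify.

Set Implicit Arguments.
Unset Strict Implicit.
Unset Printing Implicit Defensive.

(** Write [a] for the defining sequence.  The edge {x, x + j} has label
    x + a_j modulo k, so a transitive tournament is a transitive
    sigma-orientation exactly when shifting an edge by one keeps its direction
    unless its label is k - 1 ([sigma_orientationP]).

    Duality.  Reflecting the vertices by x |-> - x turns a label d of the
    partition into the label k - 1 - d of the dual ([label_dual]); hence the
    reflected tournament orients the dual.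

    Jumps.  Let s(x, j) tell whether x precedes x + j.  By the above, s(., j)
    is constant on blocks of k consecutive vertices starting at the
    x = - a_j modulo k.  Suppose that there is no jump before i, and let p run
    through the starting points of the blocks of s(., 1).  After h halts and t
    steps the blocks of s(., j) start at the p - t.  Assume that the numbers of
    halts and steps before i are both at most k - 2, or one of them is 0
    ([few_changes]).  Then transitivity on the triangles x, x + 1, x + j + 1 and x, x + j, x + j + 1
    shows inductively that s(., j) takes the value s(p, 1) on its block
    starting at p - t ([up_block]), for j at most i.  The same triangles show
    that s(., i + 1) takes the value s(p, 1) at p - t and at p + k - 2 - t,
    where t now counts the steps before i.  If the sequence jumps at i,
    then s(., i + 1) does not change between
    p + k - 2 - t and p + k - t, so that s(p, 1) = s(p + k, 1) for all p: the
    cycle 0, 1, ..., n - 1, 0 is monotone, which is absurd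
    ([up1_nonconstant]).

    Hence [few_changes] excludes a jump at an index preceded by no other jump,
    and, as it passes down to smaller indices, it excludes any jump
    ([few_changes_not_jumps]).  A jump thus comes after at least one halt and k - 1 steps, or
    after at least one step and k - 1 halts.  In particular at least k indices
    precede a jump. *)

(** * Transitive orientations and labels *)

Lemma sigma_edge_set2 n (x y : 'I_n) :
  sigma_edge [set x; y] = [set ordS x; ordS y].
Proof. by rewrite /sigma_edge imsetU1 imset_set1. Qed.

Lemma set2_Kn_edges n (x y : 'I_n) :
  ([set x; y] \in Kn_edges n) = (x != y).
Proof. by rewrite inE cards2; case: (x == y). Qed.

(** Only the edges of label k - 1 may change direction under the shift. *)
Lemma sigma_orientationP k n (F : 'I_k -> {set {set 'I_n}}) (T : rel 'I_n) :
  sigma_partition F ->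
  (forall d d' : 'I_k, d' = d.+1 :> nat ->
     sigma_digraph (oriented T (F d)) = oriented T (F d')) <->
  (forall x y, x != y -> (label F [set x; y]).+1 < k ->
     T (ordS x) (ordS y) = T x y).
Proof.
move=> pF; have sF := let: And3 _ _ s := pF in s.
have pair_inj : injective (fun p : 'I_n * 'I_n => (ordS p.1, ordS p.2)).
  move=> [x y] [x' y'] E; have /= Ex := congr1 fst E; have /= Ey := congr1 snd E.
  by rewrite (can_inj (@ordSK n) Ex) (can_inj (@ordSK n) Ey).
have mem_shift (d d' : 'I_k) x y : d' = d.+1 :> nat ->
    ([set ordS x; ordS y] \in F d') = ([set x; y] \in F d).
  by move=> /sF <-; rewrite -sigma_edge_set2 mem_imset //; apply: sigma_edge_inj.
split=> [H x y xy lk | H d d' dd'].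
  have [d hd] : exists d, [set x; y] \in F d.
    by apply: (block_ex pF); rewrite set2_Kn_edges.
  rewrite (labelE pF hd) in lk.
  have /setP /(_ (ordS x, ordS y)) := H d (Ordinal lk) erefl.
  have -> : (ordS x, ordS y) = (fun p : 'I_n * 'I_n => (ordS p.1, ordS p.2)) (x, y).
    by [].
  rewrite (mem_imset _ _ pair_inj) !inE /= hd (@mem_shift d) // hd !andbT.
  exact: esym.
apply/setP=> -[u v]; rewrite -(ord_predK u) -(ord_predK v).
set x := ord_pred u; set y := ord_pred v.
have -> : (ordS x, ordS y) = (fun p : 'I_n * 'I_n => (ordS p.1, ordS p.2)) (x, y).
  by [].
rewrite (mem_imset _ _ pair_inj) !inE /= (@mem_shift d) //.
case hd: ([set x; y] \in F d); last by rewrite !andbF.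
rewrite !andbT H //; first by rewrite -set2_Kn_edges (block_sub pF hd).
by rewrite (labelE pF hd) -dd'.
Qed.

(** * Duality *)

(** The reflection x |-> - x of the residues modulo n. *)
Definition opp_ord n (x : 'I_n) : 'I_n := ordS (rev_ord x).

Lemma val_opp_ord n (x : 'I_n) : opp_ord x = (n - x) %% n :> nat.
Proof. by rewrite /=; congr (_ %% _); have := ltn_ord x; lia. Qed.

Lemma opp_ordK n : involutive (@opp_ord n).
Proof.
move=> x; apply: val_inj; rewrite [LHS]val_opp_ord val_opp_ord.
have hx := ltn_ord x; case: (posnP x) => [x0|x0].
  by rewrite x0 subn0 modnn subn0 modnn.
by rewrite (@modn_small (n - x)) ?modn_small /=; lia.
Qed.

Lemma ordS_opp_ordS n (x : 'I_n) : ordS (opp_ord (ordS x)) = opp_ord x.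
Proof.
have hx := ltn_ord x; apply: val_inj.
rewrite -[LHS]/((opp_ord (ordS x)).+1 %% n) [RHS]val_opp_ord val_opp_ord.
rewrite -addn1 modnDml addn1 -[nat_of_ord (ordS x)]/(x.+1 %% n).
case: (ltnP x.+1 n) => h; first by rewrite (modn_small h) -subSn.
have -> : x.+1 = n by apply/eqP; rewrite eqn_leq hx h.
have -> : n - x = 1 by lia.
by rewrite modnn subn0 -addn1 modnDl.
Qed.

Lemma opp_ord_edge n (b i : nat) : b < n -> i < n ->
  [set opp_ord x | x in edge n b i] = edge n (n - b + (n - i)) i.
Proof.
move=> bn ilt.
have E (x : 'I_n) c : (opp_ord x == c %[mod n]) = ((x + c) %% n == 0).
  by rewrite val_opp_ord modn_mod -(eqn_modDl x) subnKC ?modnn ?(ltnW (ltn_ord x)) 1?eq_sym.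
have M (x : 'I_n) c d : c + d = n \/ c + d = n.*2 ->
    (x == c %[mod n]) = ((x + d) %% n == 0).
  move=> cd; rewrite -(eqn_modDr d); congr (_ == _).
  by case: cd => ->; rewrite -?addnn ?modnDl modnn.
apply/setP=> y; rewrite -(opp_ordK y) mem_imset; last exact: (inv_inj (@opp_ordK n)).
move: (opp_ord y) => z; rewrite !inE !E orbC; congr orb.
  case: (leqP (b + i) n) => h.
    rewrite (M _ _ (n - b - i)); last by left; lia.
    have -> : n - b + (n - i) = n - b - i + n by lia.
    by rewrite addnA modnDr.
  by rewrite (M _ _ (n - b + (n - i))) //; right; lia.
rewrite (M _ _ (n - b)); last by left; lia.
by rewrite -addnA subnK ?(ltnW ilt) // addnA modnDr.
Qed.

(** The reflection exchanges the label d of the partition and the label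
    k - 1 - d of its dual. *)
Lemma label_dual k n (F : 'I_k -> {set {set 'I_n}}) (x y : 'I_n) :
  1 < n -> sigma_partition F -> x != y ->
  label (dual F) [set x; y] + label F [set opp_ord x; opp_ord y] = k.-1.
Proof.
move=> n1 pF xy; have pD := dual_sigma_partition n1 pF.
have [kn _] := sigma_partition_dvdn pF n1.
have [b [i [i0 hi E]]] : exists b i : 'I_n,
    [/\ 0 < i, i <= n./2 & [set x; y] = edge n b i].
  by apply: edge_ex; rewrite set2_Kn_edges.
have hi' : 0 < i < n by rewrite i0 ltn_ord.
have ak := defining_seq_lt pF hi'.
have -> : [set opp_ord x; opp_ord y] = [set opp_ord z | z in [set x; y]].
  by rewrite imsetU1 imset_set1.
rewrite E opp_ord_edge // !label_edge // defining_seq_dual ?i0 //.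
have := @dual_seqE k (defining_seq F) i i0 (ltnW ak).
move: (dual_seq _ _ _) (defining_seq F i) ak => u a ak D.
have k0 : 0 < k by lia.
have hb := ltn_ord b.
have [q Eq] := dvdnP kn.
have EA := divn_eq (b + u) k; have EB := divn_eq (n - b + (n - i) + a) k.
have hA := ltn_pmod (b + u) k0; have hB := ltn_pmod (n - b + (n - i) + a) k0.
move: ((b + u) %% k) ((n - b + (n - i) + a) %% k) hA hB EA EB => A B hA hB EA EB.
move: ((b + u) %/ k) ((n - b + (n - i) + a) %/ k) EA EB => qA qB EA EB.
have : k %| A + B + 1.
  have E2 : (qA + qB) * k + (A + B + 1 + i) = (q + q) * k + (u + a + 1).
    by rewrite !mulnDl -Eq; lia.
  have := congr1 (modn^~ k) E2; rewrite /= !modnMDl D => Ei.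
  have : A + B + 1 == 0 %[mod k] by rewrite -(eqn_modDr i) add0n Ei.
  by rewrite mod0n.
move=> /dvdnP [r Er]; suff r1 : r = 1 by lia.
by case: r Er => [|[|r]] //; [lia | rewrite !mulSn; lia].
Qed.

Lemma dual_admits k n (F : 'I_k -> {set {set 'I_n}}) :
  1 < n -> sigma_partition F -> admits_transitive_sigma_orientation F ->
  admits_transitive_sigma_orientation (dual F).
Proof.
move=> n1 pF [T [[Tirr Ttr Ttot] /(sigma_orientationP T pF) H]].
have pD := dual_sigma_partition n1 pF.
have opp_inj := inv_inj (@opp_ordK n).
exists (fun x y => T (opp_ord x) (opp_ord y)); split.
  split=> [x|y x z|x y xy]; [exact: Tirr | exact: Ttr | apply: Ttot].
  by rewrite (inj_eq opp_inj).
apply/(sigma_orientationP _ pD) => x y xy lk.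
rewrite -(ordS_opp_ordS x) -(ordS_opp_ordS y) H ?(inj_eq opp_inj) //.
  by rewrite (inj_eq (can_inj (@ordSK n))).
have xyS : ordS x != ordS y by rewrite (inj_eq (can_inj (@ordSK n))).
have := label_dual n1 pF xyS.
rewrite -sigma_edge_set2 (label_sigma pD) ?set2_Kn_edges // modn_small //.
by move: lk; move: (label F _) (label (dual F) _) => u v; lia.
Qed.

(** * Counting halts and steps *)

Section Counting.
Variables (k n : nat) (a : nat -> nat).
Hypothesis k1 : 1 < k.

(** The numbers of indices below i where the sequence halts, resp. steps. *)
Definition nhalts i := #|[set j : 'I_i | halts n a j]|.
Definition nsteps i := #|[set j : 'I_i | steps k n a j]|.

Lemma card_ordS (P : pred nat) i :
  #|[set j : 'I_i.+1 | P j]| = #|[set j : 'I_i | P j]| + P i.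
Proof.
by rewrite -!sum1dep_card big_mkcond big_ord_recr /= -big_mkcond; case: (P i).
Qed.

Lemma nhaltsS i : nhalts i.+1 = nhalts i + halts n a i.
Proof. exact: card_ordS. Qed.

Lemma nstepsS i : nsteps i.+1 = nsteps i + steps k n a i.
Proof. exact: card_ordS. Qed.

Lemma card_ord0 (P : pred 'I_0) : #|[set j | P j]| = 0.
Proof. by apply/eqP; rewrite cards_eq0; apply/eqP/setP=> -[]. Qed.

Lemma nhalts1 : nhalts 1 = 0.
Proof. by rewrite nhaltsS /nhalts card_ord0. Qed.

Lemma nsteps1 : nsteps 1 = 0.
Proof. by rewrite nstepsS /nsteps card_ord0. Qed.

Lemma leq_nhalts i j : i <= j -> nhalts i <= nhalts j.
Proof.
move/subnKC <-; elim: (j - i) => [|d IH]; first by rewrite addn0.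
by rewrite addnS nhaltsS (leq_trans IH) // leq_addr.
Qed.

Lemma leq_nsteps i j : i <= j -> nsteps i <= nsteps j.
Proof.
move/subnKC <-; elim: (j - i) => [|d IH]; first by rewrite addn0.
by rewrite addnS nstepsS (leq_trans IH) // leq_addr.
Qed.

Lemma halts_nsteps j : halts n a j -> steps k n a j = false.
Proof.
rewrite /halts /steps => /andP [-> /eqP ->] /=; apply/negbTE.
by rewrite -{1}[a j]addn0 eqn_modDl mod0n modn_small.
Qed.

Lemma nhalts_nsteps_lt i : 0 < i -> nhalts i + nsteps i < i.
Proof.
case: i => // i _; elim: i => [|i IH]; first by rewrite nhalts1 nsteps1.
rewrite nhaltsS nstepsS; case: (boolP (halts n a i.+1)) => [/halts_nsteps ->|_] /=.
  by lia.
by case: (steps _ _ _ _); lia.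
Qed.

(** The negation of: at least one halt and k - 1 steps before i, or at least
    one step and k - 1 halts. *)
Definition few_changes i :=
  ((nhalts i == 0) || (nsteps i <= k - 2))
  && ((nsteps i == 0) || (nhalts i <= k - 2)).

Lemma few_changesW i j : i <= j -> few_changes j -> few_changes i.
Proof.
move=> ij; have := leq_nhalts ij; have := leq_nsteps ij.
by rewrite /few_changes; lia.
Qed.

Lemma nhalts_gt0 i : 0 < nhalts i -> exists j, j < i /\ halts n a j.
Proof. by case/card_gt0P=> j; rewrite inE; exists j. Qed.

Lemma nsteps_gt0 i : 0 < nsteps i -> exists j, j < i /\ steps k n a j.
Proof. by case/card_gt0P=> j; rewrite inE; exists j. Qed.

End Counting.

(** * Blocks of constant direction *)

(** The vertex x modulo n. *)
Definition vertex n (n0 : 0 < n) (x : nat) : 'I_n := Ordinal (ltn_pmod x n0).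

Section Direction.
Variables (k n : nat) (F : 'I_k -> {set {set 'I_n}}) (T : rel 'I_n).
Hypotheses (k1 : 1 < k) (n0 : 0 < n) (pF : sigma_partition F).
Hypothesis oT : transitive_sigma_orientation F T.

Local Notation a := (defining_seq F).
Local Notation nhalts := (nhalts n a).
Local Notation nsteps := (nsteps k n a).
Local Notation few_changes := (few_changes k n a).

(** Whether the vertex x precedes x + j, both read modulo n. *)
Definition up (x j : nat) : bool := T (vertex n0 x) (vertex n0 (x + j)).

Lemma vertexS x : ordS (vertex n0 x) = vertex n0 x.+1.
Proof. by apply: val_inj; rewrite /= -addn1 modnDml addn1. Qed.

Lemma vertex_edge x j : [set vertex n0 x; vertex n0 (x + j)] = edge n x j.
Proof. by apply/setP=> z; rewrite !inE -!val_eqE /= (modn_small (ltn_ord z)). Qed.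

Lemma vertex_neq x j : 0 < j < n -> vertex n0 x != vertex n0 (x + j).
Proof.
by case/andP=> j0 jn; rewrite -set2_Kn_edges vertex_edge edge_in.
Qed.

(** The edge {x, x + j} has label x + a_j, and label k - 1 is excluded. *)
Lemma up_shift x j : 0 < j < n -> (x + a j).+1 %% k != 0 ->
  up x.+1 j = up x j.
Proof.
move=> hj hx; have [_ /(sigma_orientationP T pF) H] := oT.
rewrite /up addSn -!vertexS H ?vertex_neq // vertex_edge label_edge //.
have k0 : 0 < k by lia.
have := ltn_pmod (x + a j) k0; rewrite leq_eqVlt => /orP [/eqP E|//].
by case/negP: hx; rewrite -addn1 -modnDml addn1 E modnn.
Qed.

(** Transitivity on the triangle x, x + j, x + j + l, for either direction. *)
Lemma up_add x j l : 0 < j -> 0 < l -> j + l < n -> up x j = up (x + j) l ->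
  up x (j + l) = up x j.
Proof.
move=> j0 l0 jl; have [[_ Ttr Ttot] _] := oT.
have hj : 0 < j < n by lia.
have hl : 0 < l < n by lia.
have hjl : 0 < j + l < n by lia.
have := Ttot _ _ (vertex_neq x hj); have := Ttot _ _ (vertex_neq (x + j) hl).
have := Ttot _ _ (vertex_neq x hjl); rewrite /up addnA.
have := Ttr (vertex n0 (x + j)) (vertex n0 x) (vertex n0 (x + j + l)).
have := Ttr (vertex n0 (x + j)) (vertex n0 (x + j + l)) (vertex n0 x).
by do 6 case: (T _ _) => //=; move=> // ? ?; intuition.
Qed.

(** The order cannot be monotone along the whole closed walk m, m + 1, ...,
    m + n = m. *)
Lemma up1_nonconstant (v : bool) m : 1 < n ->
  ~ (forall x, m <= x -> up x 1 = v).
Proof.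
move=> n1 U; have [[Tirr Ttr Ttot] _] := oT.
have S j : 0 < j < n -> up m j = v.
  elim: j => // -[_ _|j IH hj]; first by rewrite U.
  have IHj : up m j.+1 = v by apply: IH; lia.
  by rewrite -addn1 up_add ?IHj ?U ?addn1 //; lia.
have hn : 0 < n.-1 < n by lia.
have := S _ hn; have := U (m + n.-1) (leq_addr _ _).
have := Ttot _ _ (vertex_neq m hn); rewrite /up.
have -> : vertex n0 (m + n.-1 + 1) = vertex n0 m.
  by apply: val_inj; rewrite /= -addnA addn1 prednK // modnDr.
by move=> + E1 E2; rewrite E1 E2; case: (v).
Qed.

Lemma up_const x d j : 0 < j < n -> (x + a j) %% k + d < k ->
  up (x + d) j = up x j.
Proof.
move=> hj; elim: d => [|d IH] hd; first by rewrite addn0.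
rewrite addnS up_shift ?IH //; first by lia.
have -> : (x + d + a j).+1 = x + a j + d.+1 by lia.
by rewrite -modnDml modn_small //; lia.
Qed.

(** If p starts a block of [up _ 1] and a_j = a_1 + s modulo k, then p - s
    starts a block of [up _ j]; x and y lie in it at the offsets t and u. *)
Lemma up_same_block j s p x y t u : 0 < j < n -> k %| p + a 1 ->
  a j = a 1 + s %[mod k] -> x + s = p + t -> y + s = p + u ->
  t < k -> u < k -> up x j = up y j.
Proof.
move=> hj hp ha; wlog le_tu : x y t u / t <= u => [H|] hx hy ht hu.
  by case/orP: (leq_total t u) => h; [|symmetry]; apply: H h _ _ _ _.
have -> : y = x + (u - t) by lia.
rewrite up_const //.
have -> : (x + a j) %% k = t.
  have [q Eq] := dvdnP hp.
  rewrite -modnDmr ha modnDmr.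
  have -> : x + (a 1 + s) = q * k + t by lia.
  by rewrite modnMDl modn_small.
by lia.
Qed.

(** * The first jump *)

Section NoEarlierJump.
Variable i : nat.
Hypotheses (i_lt : i < n./2) (no_jump : forall j, j < i -> ~~ jumps k n a j).
Hypothesis few : few_changes i.

Lemma halts_or_steps j : 0 < j < i -> halts n a j || steps k n a j.
Proof.
move=> hj; have hji : j < i by lia.
have := no_jump hji; rewrite /jumps.
have -> : seq_index n j by rewrite /seq_index; lia.
by case: (halts n a j); case: (steps k n a j).
Qed.

Lemma nhalts_nsteps j : 0 < j <= i ->
  j = (1 + nhalts j + nsteps j) /\ a j = a 1 + nsteps j %[mod k].
Proof.
elim: j => // -[_ _|j IH hj]; first by rewrite nhalts1 nsteps1 !addn0.
have [Ej Ea] : j.+1 = 1 + nhalts j.+1 + nsteps j.+1 /\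
    a j.+1 = a 1 + nsteps j.+1 %[mod k] by apply: IH; lia.
have /halts_or_steps : 0 < j.+1 < i by lia.
rewrite [nhalts j.+2]nhaltsS [nsteps j.+2]nstepsS.
case: (boolP (halts n a j.+1)) => [h _|_ /= h].
  rewrite (halts_nsteps k1 h); case/andP: h => _ /eqP ->.
  by rewrite addn0; split=> //; lia.
rewrite h; case/andP: h => _ /eqP ->; split; first by lia.
by rewrite addnA -[RHS]modnDml -Ea modnDml.
Qed.

(** The triangle x, x + j, x + j + 1 at the starting point p - s of a
    block of [up _ j], where s is the number of steps before j. *)
Lemma up_block_start j p : 0 < j <= i -> nhalts j <= k - 2 ->
    (forall x t, x + nsteps j = p + t -> t < k -> up x j = up p 1) ->
    n <= p -> k %| p + a 1 ->
  up (p - nsteps j) j.+1 = up p 1.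
Proof.
move=> hj hh U pn hp; have [Ej _] := nhalts_nsteps hj.
have sp : nsteps j <= p by lia.
have U0 : up (p - nsteps j) j = up p 1 by apply: (U _ 0); lia.
rewrite -addn1 up_add ?U0 //; [by lia | by lia |].
by apply: (@up_same_block 1 0 p _ _ 0 (nhalts j).+1) => //; rewrite ?addn0; lia.
Qed.

(** The triangle x, x + 1, x + j + 1 at x = p + k - 2 - s. *)
Lemma up_block_end j p : 0 < j <= i -> nsteps j <= k - 2 ->
    (forall x t, x + nsteps j = p + t -> t < k -> up x j = up p 1) ->
    k %| p + a 1 ->
  up (p + (k - 2 - nsteps j)) j.+1 = up p 1.
Proof.
move=> hj hs U hp.
set y := p + _.
have U0 : up y 1 = up p 1.
  by apply: (@up_same_block 1 0 p _ _ (k - 2 - nsteps j) 0) => //;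
    rewrite ?addn0 /y; lia.
have U1 : up (y + 1) j = up p 1 by apply: (U _ k.-1); rewrite /y; lia.
by rewrite -add1n up_add ?U0 ?U1 //; lia.
Qed.

(** By induction on j: a halt keeps the starting points of the blocks, a step
    moves them by - 1, and one vertex of the new block decides its value.  If
    some index before i halts, there are at most k - 2 steps by [few], and vice
    versa.  The bound
    [n <= p] keeps p - s a natural number. *)
Lemma up_block j p x t : 0 < j <= i -> n <= p -> k %| p + a 1 ->
  x + nsteps j = p + t -> t < k -> up x j = up p 1.
Proof.
move=> + pn hp; elim: j x t => // -[_ x t _|j IH x t hj].
  rewrite nsteps1 => hx ht.
  by apply: (@up_same_block 1 0 p _ _ t 0) => //; rewrite ?addn0; lia.
have hj' : 0 < j.+1 <= i by lia.
have {}IH x' t' := IH x' t' hj'.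
have hjn : 0 < j.+2 < n by lia.
have [Ej Ea] := nhalts_nsteps hj.
have /halts_or_steps : 0 < j.+1 < i by lia.
have HH := leq_nhalts n a (proj2 (andP hj)); have SS := leq_nsteps k n a (proj2 (andP hj)).
move: HH SS few Ej Ea; rewrite /few_changes.
rewrite [nhalts j.+2]nhaltsS [nsteps j.+2]nstepsS.
case: (boolP (halts n a j.+1)) => [h|_ /=].
  rewrite (halts_nsteps k1 h) addn0 => HH SS fw Ej Ea _ hx ht.
  have hs : nsteps j.+1 <= k - 2 by move: fw HH SS; clear; lia.
  rewrite -(up_block_end hj' hs IH hp).
  by apply: (@up_same_block _ (nsteps j.+1) p _ _ t (k - 2)) => //; lia.
case: (boolP (steps k n a j.+1)) => //= h HH SS fw Ej Ea _ hx ht.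
have hh : nhalts j.+1 <= k - 2 by move: fw HH SS; clear; lia.
rewrite -(up_block_start hj' hh IH pn hp).
by apply: (@up_same_block _ (nsteps j.+1 + 1) p _ _ t 1) => //; lia.
Qed.

(** Both edges {x, x + i + 1} with x = p + k - 2 - s, p + k - s have known
    directions, and no change is possible between them at a jump. *)
Lemma not_jumps : 1 < n -> ~~ jumps k n a i.
Proof.
move=> n1; apply/negP=> /and3P [hi nh ns].
have hi' : 0 < i <= i by case/andP: hi => ->; rewrite leqnn.
have [Ei Ea] := nhalts_nsteps hi'.
set s := nsteps i in Ea Ei *; set h := nhalts i in Ei *.
have hin : 0 < i.+1 < n by lia.
have Ustart p : n <= p -> k %| p + a 1 -> up (p - s) i.+1 = up p 1.
  move=> pn hp; have U x t := @up_block i p x t hi' pn hp.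
  case: (leqP h (k - 2)) => hh; first exact: up_block_start.
  (* There are no steps here, and the other triangle serves at p as well. *)
  have s0 : s = 0 by move: few hh; rewrite /few_changes -/s -/h; lia.
  have U1 : up (p + 1) i = up p 1 by apply: (U _ 1); rewrite -/s; lia.
  by rewrite s0 subn0 -(add1n i) up_add ?U1 //; lia.
have Uend p : n <= p -> k %| p + a 1 -> up (p + k - 2 - s) i.+1 = up p 1.
  move=> pn hp; have U x t := @up_block i p x t hi' pn hp.
  case: (leqP s (k - 2)) => hs.
    have -> : p + k - 2 - s = p + (k - 2 - s) by lia.
    exact: up_block_end.
  (* There are no halts here, and the other triangle serves at p + k - 2 - s. *)
  have h0 : h = 0 by move: few hs; rewrite /few_changes -/s -/h; lia.
  have U0 : up (p + k - 2 - s) i = up p 1 by apply: (U _ (k - 2)); rewrite -/s; lia.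
  rewrite -(addn1 i) up_add ?U0 //; [by lia | by lia |].
  by apply: (@up_same_block 1 0 p _ _ 0 k.-1) => //; rewrite ?addn0; lia.
have Unext p : n <= p -> k %| p + a 1 -> up (p + k) 1 = up p 1.
  move=> pn hp.
  have hpk : k %| p + k + a 1 by rewrite addnAC dvdn_addl.
  rewrite -(Ustart _ (leq_trans pn (leq_addr k p)) hpk) -(Uend _ pn hp).
  set y := p + k - 2 - s.
  have -> : p + k - s = y.+2 by rewrite /y; lia.
  have Ey : y + 2 + a i = 0 %[mod k].
    rewrite -modnDmr Ea modnDmr; have -> : y + 2 + (a 1 + s) = p + k + a 1.
      by rewrite /y; lia.
    by apply/eqP; rewrite mod0n.
  have ak j : 0 < j < n -> a j < k by apply: defining_seq_lt.
  rewrite !up_shift //.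
    apply: contra ns => E; rewrite /steps hi /= -(eqn_modDl y.+1).
    have -> : y.+1 + (a i + 1) = y + 2 + a i by lia.
    have -> : y.+1 + a i.+1 = (y + a i.+1).+1 by lia.
    by rewrite Ey mod0n.
  apply: contra nh => E; rewrite /halts hi /=.
  have : a i.+1 == a i %[mod k].
    rewrite -(eqn_modDl (y + 2)) Ey mod0n.
    by have -> : y + 2 + a i.+1 = (y.+1 + a i.+1).+1 by lia.
  by rewrite !modn_small // ak; lia.
pose p0 := n * k + (k - a 1).
have a1k : a 1 < k by apply: (defining_seq_lt pF); lia.
have hp0 : k %| p0 + a 1 by rewrite /p0 -addnA subnK ?(ltnW a1k) // dvdn_addl ?dvdn_mull.
have p0n : n <= p0 by rewrite /p0 (leq_trans (leq_pmulr n (ltnW k1))) // leq_addr.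
apply: (@up1_nonconstant (up p0 1) p0 n1) => x xp.
have Uq q : up (p0 + q * k) 1 = up p0 1.
  elim: q => [|q IH]; first by rewrite addn0.
  rewrite mulSnr addnA Unext //; first by rewrite (leq_trans p0n) ?leq_addr.
  by rewrite addnAC dvdn_addl ?dvdn_mull.
have k0 : 0 < k by lia.
rewrite -(Uq ((x - p0) %/ k)).
apply: (@up_same_block 1 0 (p0 + (x - p0) %/ k * k) _ _ ((x - p0) %% k) 0) => //.
- by rewrite addnAC dvdn_addl ?dvdn_mull.
- by rewrite addn0.
- by rewrite addn0 -addnA -divn_eq subnKC.
- exact: ltn_pmod.
Qed.

End NoEarlierJump.

Lemma few_changes_not_jumps i : 1 < n -> few_changes i -> ~~ jumps k n a i.
Proof.
move=> n1; elim/ltn_ind: i => i IH fw; case: (ltnP i n./2) => hi; last first.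
  by apply/negP=> /andP [/andP [_]]; rewrite ltnNge hi.
by apply: not_jumps => // j ji; apply: IH => //; exact: few_changesW (ltnW ji) fw.
Qed.

End Direction.

Theorem theorem6 (k n : nat) (hk : 1 < k) (hn : 1 < n) :
  (forall F : 'I_k -> {set {set 'I_n}},
     sigma_partition F -> admits_transitive_sigma_orientation F ->
     admits_transitive_sigma_orientation (dual F)) /\
  (forall F : 'I_k -> {set {set 'I_n}},
     sigma_partition F -> admits_transitive_sigma_orientation F ->
     (forall i : nat, jumps k n (defining_seq F) i ->
        ((exists j : nat, j < i /\ halts n (defining_seq F) j) /\
         k - 1 <= #|[set j' : 'I_i | steps k n (defining_seq F) j']|) \/
        ((exists j : nat, j < i /\ steps k n (defining_seq F) j) /\
         k - 1 <= #|[set j' : 'I_i | halts n (defining_seq F) j']|)) /\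
     (forall i : nat, i <= k -> ~~ jumps k n (defining_seq F) i)).
Proof.
split=> [F pF|F pF [T oT]]; first exact: dual_admits.
have n0 : 0 < n by lia.
have J i := @few_changes_not_jumps k n F T hk n0 pF oT i hn.
split=> i.
  move=> hi; have : ~~ few_changes k n (defining_seq F) i by apply: contraL hi; apply: J.
  rewrite negb_and !negb_or -!lt0n => /orP [] /andP [h1 h2]; [left|right].
    by split; [apply: nhalts_gt0 | move: h2; rewrite /nsteps; lia].
  by split; [apply: nsteps_gt0 | move: h2; rewrite /nhalts; lia].
move=> ik; case: (posnP i) => [->|i0]; first by rewrite /jumps /seq_index.
by apply: J; have := nhalts_nsteps_lt n (defining_seq F) hk i0; rewrite /few_changes; lia.
Qed.
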